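(* Let $\theta\ge0$. If $1<p_2\le p_1<\infty$ and $1<q<\infty$, then $$W(L^{p_1),\theta},L^{q),\theta})\subset W(L^{p_2),\theta},L^{q),\theta}).$$
   Context: $\Omega$ is a locally compact Hausdorff space with a finite Borel measure $\mu$, and $Q\subset\Omega$ is a fixed compact subset with nonempty interior. To make sense of translates, $\Omega$ is a locally compact Borel subset (possibly all) of a locally compact Hausdorff abelian group $G$, written additively; for $x\in\Omega$, $Q+x=\{t+x:t\in Q\}$ and $\chi_{Q+x}$ is the characteristic function of $(Q+x)\cap\Omega$ on $\Omega$. Functions are identified when equal $\mu$-a.e. Generalized grand Lebesgue space: for $1<p<\infty$, $\theta\ge0$, $L^{p),\theta}=L^{p),\theta}(\mu)$ is the space of measurable $f$ with $\|f\|_{p),\theta}=\sup_{0<\varepsilon\le p-1}\varepsilon^{\frac{\theta}{p-\varepsilon}}\left(\int_\Omega|f|^{p-\varepsilon}d\mu\right)^{\frac1{p-\varepsilon}}<\infty$. $(L^{p),\theta})_{loc}$ is the space of measurable $f$ with $f\chi_K\in L^{p),\theta}$ for every compact $K\subset\Omega$. Grand Wiener amalgam space: for $1<p,q<\infty$, $W(L^{p),\theta},L^{q),\theta})$ is the space of $f\in(L^{p),\theta})_{loc}$ such that $F_f^{p),\theta}(x)=\|f\chi_{Q+x}\|_{p),\theta}$ lies in $L^{q),\theta}$, with norm $\|F_f^{p),\theta}\|_{q),\theta}$.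
   Formalization: For a non-regular finite Borel measure the control function F_f for p_2 may fail to be measurable, so the inclusion is proved for regular μ, and for arbitrary finite Borel μ for those f in the first space whose control function F_f for p_2 is measurable. *)

(* Defs.v *)
(* MathComp-Analysis *)
From HB Require Import structures.
From mathcomp Require Import all_boot all_order all_algebra.
From mathcomp Require Import all_classical all_reals all_analysis.
From mathcomp Require Import measurable_realfun.

Set Implicit Arguments.
Unset Strict Implicit.
Unset Printing Implicit Defensive.

Import Order.TTheory GRing.Theory Num.Theory.
Import numFieldNormedType.Exports.

Local Open Scope classical_set_scope.
Local Open Scope ring_scope.
Local Open Scope ereal_scope.

Notation borel T := (g_sigma_algebraType (@open T)).

(* The space Omega sits in the group G through the inclusion iota; saying that
   Omega is a subspace means that its topology is the one induced by iota. *)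
Definition topological_embedding (X Y : topologicalType) (i : X -> Y) : Prop :=
  injective i /\
  (forall U : set X, open U <-> exists2 V : set Y, open V & i @^-1` V = U).

(* For a finite measure on a Hausdorff space this is the usual regularity of
   Borel measures: outer regularity follows by taking complements. *)
Definition regular_measure (R : realType) (T : ptopologicalType)
    (mu : {finite_measure set (borel T) -> \bar R}) : Prop :=
  forall B : set (borel T), measurable B ->
    mu B = ereal_sup [set mu K | K in [set K : set T | compact K /\ K `<=` B]].

Section grand_lebesgue.
Context d (T : measurableType d) (R : realType).
Variable mu : {measure set T -> \bar R}.
Variables p theta : R.

Definition grand_norm (f : T -> \bar R) : \bar R :=
  ereal_sup [set (eps `^ (theta / (p - eps)))%:E * 'N[mu]_((p - eps)%:E)[f]
            | eps in `]0%R, (p - 1)%R]].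

(* Functions take extended real values so that the same space can host control
   functions, which may be infinite on a null set. *)
Definition grand_Lebesgue : set (T -> \bar R) :=
  [set f : T -> \bar R | measurable_fun [set: T] f /\ grand_norm f < +oo].

End grand_lebesgue.

Section grand_amalgam.
Context (R : realType) (Omega : ptopologicalType) (G : topologicalZmodType).
Variable iota : Omega -> G.
Variable mu : {finite_measure set (borel Omega) -> \bar R}.
Variable Q : set Omega.

(* (Q + x) `&` Omega, as a subset of Omega. *)
Definition translate (x : Omega) : set Omega :=
  [set s | exists2 t, Q t & iota s = (iota t + iota x)%R].

(* The base point of \bar R is 0, so f \_ K is f times the indicator of K. *)
Definition grand_Lebesgue_loc (p theta : R) : set (Omega -> \bar R) :=
  [set f : Omega -> \bar R | measurable_fun [set: borel Omega] f /\
    forall K : set Omega, compact K -> grand_Lebesgue mu p theta (f \_ K)].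

Definition control (p theta : R) (f : Omega -> \bar R) : Omega -> \bar R :=
  fun x => grand_norm mu p theta (f \_ (translate x)).

Definition grand_amalgam (p q theta : R) : set (Omega -> \bar R) :=
  [set f : Omega -> \bar R | grand_Lebesgue_loc p theta f /\
           grand_Lebesgue mu q theta (control p theta f)].

End grand_amalgam.

(* Main.v *)
Require Import Defs.
From HB Require Import structures.
From mathcomp Require Import all_boot all_order all_algebra.
From mathcomp Require Import all_classical all_reals all_analysis.
From mathcomp Require Import measurable_realfun.
From mathcomp Require Import ring lra.

Set Implicit Arguments.
Unset Strict Implicit.
Unset Printing Implicit Defensive.

Import Order.TTheory GRing.Theory Num.Theory.
Import numFieldNormedType.Exports.

Local Open Scope classical_set_scope.
Local Open Scope ring_scope.

(** The norm estimate is Hoelder's inequality on a finite measure space.  If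
    [mu Omega <= M] and [1 <= M], then for [0 < eps <= p2 - 1] the exponents
    [r = p2 - eps] and [s = p1 - eps] satisfy [1 <= r <= s], hence
    [|f|_r <= M ^ (1/r - 1/s) |f|_s <= M |f|_s], while the weights differ by the
    factor [eps ^ (theta (1/r - 1/s)) <= p1 ^ theta].  Keeping the same [eps] on
    both sides therefore gives [|f|_{p2),theta} <= C |f|_{p1),theta} ] with
    [C = M p1 ^ theta] independent of [f] ([grand_norm_le_exponent]).  Applied
    to [f] cut off to compact sets it gives the local condition; applied to the
    cut-offs to translates of [Q] it gives a pointwise bound between the control
    functions, and the outer norm is monotone and homogeneous
    ([grand_amalgam_sub]).

    What remains is the measurability of the new control function, and this is
    where regularity of [mu] enters ([measurable_control]).

    - For a Borel set [B] the map [x |-> mu (B & (Q + x))] is upper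
      semicontinuous.  By inner regularity almost all of the complement of
      [Q + x0] lies in a compact [K] disjoint from [Q + x0]; the points [x] for
      which [Q + x] meets [K] are those with [iota x] in the compact set
      [K - Q], so [Q + x] avoids [K] for all [x] near [x0]
      ([open_measure_translate_lt]).
    - Hence the restrictions of [mu] to the translates form a kernel, and
      [x |-> \int_(Q + x) |f| ^ r] is measurable for every [r].
    - The grand norm is a supremum of such quantities over an uncountable
      interval, but rational [eps] suffice: by the Hoelder comparison the terms
      at smaller parameters bound the term at [eps] from above, up to a factor
      that tends to [1] ([grand_norm_esups]). *)

(** * Lebesgue norms on a space of finite measure *)

Section Lnorm_facts.
Context d (T : measurableType d) (R : realType).
Variable mu : {measure set T -> \bar R}.
Local Open Scope ereal_scope.
Implicit Types (f g : T -> \bar R) (r s c M : R).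

Lemma le_poweR (x y : \bar R) r : (0 <= r)%R -> 0 <= x -> x <= y ->
  x `^ r <= y `^ r.
Proof.
move=> r0 x0 xy; apply: gt0_ler_poweR => //; rewrite in_itv/= ?leey ?andbT//.
exact: le_trans xy.
Qed.

Lemma measurable_abse_poweR f r : measurable_fun [set: T] f ->
  measurable_fun [set: T] (fun x => `|f x| `^ r).
Proof.
move=> mf; apply: (measurableT_comp (measurable_poweR r)).
exact: measurableT_comp.
Qed.

Lemma LnormE f r : 'N[mu]_(r%:E)[f] = (\int[mu]_x `|f x| `^ r) `^ r^-1.
Proof. by rewrite unlock. Qed.

Lemma Lnorm_patch (A : set T) f r : r != 0%R ->
  'N[mu]_(r%:E)[f \_ A] = (\int[mu]_(x in A) `|f x| `^ r) `^ r^-1.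
Proof.
move=> r0; rewrite LnormE [in RHS]integral_mkcond; congr (_ `^ _).
apply: eq_integral => x _; rewrite !patchE.
by case: ifPn => // _; rewrite abse0 poweR0r.
Qed.

Lemma Lnorm_le_scale f g r c : (0 < r)%R -> (0 <= c)%R ->
    measurable_fun [set: T] f -> measurable_fun [set: T] g ->
    (forall x, `|f x| <= c%:E * `|g x|) ->
  'N[mu]_(r%:E)[f] <= c%:E * 'N[mu]_(r%:E)[g].
Proof.
move=> r0 c0 mf mg fg; rewrite !LnormE.
have rN0 : r != 0%R by rewrite gt_eqF.
have i0 h : 0 <= \int[mu]_x `|h x| `^ r.
  by apply: integral_ge0 => x _; exact: poweR_ge0.
have -> : c%:E = (c%:E `^ r) `^ r^-1.
  by rewrite -poweRrM mulfV// poweRe1// lee_fin.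
rewrite -poweRM ?poweR_ge0// le_poweR// ?invr_ge0 ?(ltW r0)//.
rewrite -ge0_integralZl//; last 3 first.
- exact: measurable_abse_poweR.
- by move=> x _; exact: poweR_ge0.
- exact: poweR_ge0.
apply: ge0_le_integral => //.
- by move=> x _; exact: poweR_ge0.
- exact: measurable_abse_poweR.
- by apply: measurable_funeM; exact: measurable_abse_poweR.
by move=> x _; rewrite -poweRM// le_poweR// ltW.
Qed.

(** A function with a finite norm is finite almost everywhere, so it may be
    replaced by a real-valued one, to which Hoelder's inequality applies. *)
Lemma Lnorm_lty_fine f r s : (0 < s)%R -> measurable_fun [set: T] f ->
  'N[mu]_(s%:E)[f] < +oo ->
  'N[mu]_(r%:E)[f] = 'N[mu]_(r%:E)[EFin \o (fine \o f)].
Proof.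
move=> s0 mf; rewrite [X in X < _]LnormE => /lty_poweRy.
rewrite invr_eq0 gt_eqF// => /(_ isT) fs.
have /integrable_ae -/(_ measurableT) ffin :
    mu.-integrable [set: T] (fun x => `|f x| `^ s).
  apply/integrableP; split; first exact: measurable_abse_poweR.
  by under eq_integral do rewrite gee0_abs ?poweR_ge0//.
rewrite !LnormE; congr (_ `^ _); apply: ae_eq_integral => //.
- exact: measurable_abse_poweR.
- apply: measurable_abse_poweR; apply/measurable_EFinP.
  exact: measurableT_comp.
apply: filterS ffin => x + _ => /(_ I) fx /=.
by move: fx; case: (f x) => //=; rewrite gt_eqF.
Qed.

(** Hoelder's inequality for [|f| ^ r] and the constant [1], with the exponent
    [s / r] and its conjugate.  The upper bound [M] replaces the total mass so
    that its powers are invertible even for the zero measure. *)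
Lemma Lnorm_le_Lnorm f r s M : (0 < r)%R -> (r <= s)%R -> (0 < M)%R ->
    mu [set: T] <= M%:E -> measurable_fun [set: T] f ->
  'N[mu]_(r%:E)[f] <= (M `^ (r^-1 - s^-1))%:E * 'N[mu]_(s%:E)[f].
Proof.
move=> r0 rs M0 muM mf; have s0 := lt_le_trans r0 rs.
move: rs; rewrite le_eqVlt => /predU1P[<-|rs].
  by rewrite subrr powRr0 mul1e.
have [->|] := eqVneq 'N[mu]_(s%:E)[f] +oo.
  by rewrite gt0_muley ?lte_fin ?powR_gt0// leey.
rewrite -ltey => fs.
rewrite !(Lnorm_lty_fine _ s0 mf fs); set g := fine \o f.
have mg : measurable_fun [set: T] g by exact: measurableT_comp.
pose a := (s / r)%R; pose b := (1 - a^-1)^-1%R.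
have a0 : (0 < a)%R by rewrite divr_gt0.
have b0 : (0 < b)%R.
  by rewrite invr_gt0 subr_gt0 invf_lt1// ltr_pdivlMr// mul1r.
have ab : (a^-1 + b^-1 = 1)%R by rewrite /b invrK subrKC.
have mgr : measurable_fun [set: T] (fun x => `|g x| `^ r)%R.
  apply: (@measurableT_comp _ _ _ _ _ _ (@powR R ^~ r)) => //.
  exact: measurableT_comp.
have := @hoelder _ _ _ mu (fun x => `|g x| `^ r)%R (cst 1%R) a b mgr
  (@measurable_cst _ _ _ _ _ _) a0 b0 ab.
rewrite Lnorm_cst1 Lnorm1 LnormE.
under eq_integral do rewrite /= mulr1 ger0_norm ?powR_ge0//.
under [X in X `^ a^-1]eq_integral do
  rewrite /= ger0_norm ?powR_ge0// -powRrM mulrC divfK ?gt_eqF//.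
move=> H; rewrite !LnormE.
have i0 t : 0 <= \int[mu]_x (`|g x| `^ t)%:E.
  by apply: integral_ge0 => x _; rewrite lee_fin powR_ge0.
have c0 : 0 <= mu [set: T] `^ b^-1 by exact: poweR_ge0.
have {}H : \int[mu]_x (`|g x| `^ r)%:E
    <= (\int[mu]_x (`|g x| `^ s)%:E) `^ a^-1 * M%:E `^ b^-1.
  apply: (le_trans H); apply: lee_pmul; rewrite ?poweR_ge0//.
  by rewrite le_poweR// invr_ge0 ltW.
have -> : (r^-1 - s^-1 = b^-1 * r^-1)%R.
  by rewrite /b invrK /a; field; rewrite !gt_eqF.
have -> : (s^-1 = a^-1 * r^-1)%R by rewrite /a; field; rewrite !gt_eqF.
rewrite -poweR_EFin !poweRrM muleC -poweRM ?poweR_ge0//.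
by apply: le_poweR; [rewrite invr_ge0 ltW|exact: i0|exact: H].
Qed.

End Lnorm_facts.

(** * The grand norm *)

Section grand_norm_facts.
Context d (T : measurableType d) (R : realType).
Variable mu : {measure set T -> \bar R}.
Local Open Scope ereal_scope.
Implicit Types (f g : T -> \bar R) (p theta eps c M : R).

Definition grand_term p theta f eps : \bar R :=
  (eps `^ (theta / (p - eps)))%:E * 'N[mu]_((p - eps)%:E)[f].

Lemma grand_term_le p theta f eps : (0 < eps <= p - 1)%R ->
  grand_term p theta f eps <= grand_norm mu p theta f.
Proof.
by move=> epsp; apply: ereal_sup_ubound; exists eps => //=; rewrite in_itv.
Qed.

Lemma grand_norm_ge0 p theta f : (1 < p)%R -> 0 <= grand_norm mu p theta f.
Proof.
move=> p1; apply: (@le_trans _ _ (grand_term p theta f (p - 1))).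
  by rewrite mule_ge0 ?Lnorm_ge0// lee_fin powR_ge0.
by apply: grand_term_le; rewrite lexx subr_gt0 p1.
Qed.

Lemma grand_norm_le_scale p theta f g c : (0 <= c)%R ->
    measurable_fun [set: T] f -> measurable_fun [set: T] g ->
    (forall x, `|f x| <= c%:E * `|g x|) ->
  grand_norm mu p theta f <= c%:E * grand_norm mu p theta g.
Proof.
move=> c0 mf mg fg; apply: ge_ereal_sup => _ [eps /= + <-].
rewrite in_itv/= => /andP[e0 ep].
have pe0 : (0 < p - eps)%R by lra.
apply: (@le_trans _ _ (c%:E * grand_term p theta g eps)); last first.
  by rewrite lee_wpmul2l// grand_term_le// e0.
rewrite /grand_term muleCA lee_wpmul2l ?lee_fin ?powR_ge0//.
exact: Lnorm_le_scale.
Qed.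

(** The terms of the two suprema are compared at the same [eps], which is
    admissible for [p1] because [p2 <= p1]. *)
Lemma grand_norm_le_exponent p1 p2 theta M f :
    (1 < p2)%R -> (p2 <= p1)%R -> (0 <= theta)%R -> (1 <= M)%R ->
    mu [set: T] <= M%:E -> measurable_fun [set: T] f ->
  grand_norm mu p2 theta f <= (M * p1 `^ theta)%:E * grand_norm mu p1 theta f.
Proof.
move=> p21 p21' th0 M1 muM mf; apply: ge_ereal_sup => _ [eps /= + <-].
rewrite in_itv/= => /andP[e0 ep].
have [r1 rs] : (1 <= p2 - eps)%R /\ (p2 - eps <= p1 - eps)%R by split; lra.
set r := (p2 - eps)%R in r1 rs *; set s := (p1 - eps)%R in rs *.
have [r0 s0] : (0 < r)%R /\ (0 < s)%R by split; lra.
set D := (r^-1 - s^-1)%R.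
have D0 : (0 <= D)%R by rewrite subr_ge0 lef_pV2.
have D1 : (D <= 1)%R.
  have : (r^-1 <= 1)%R by rewrite invf_le1.
  have : (0 < s^-1)%R by rewrite invr_gt0.
  by rewrite /D; lra.
apply: (@le_trans _ _ ((M * p1 `^ theta)%:E * grand_term p1 theta f eps));
    last first.
  rewrite lee_wpmul2l ?lee_fin ?mulr_ge0 ?powR_ge0//; first by lra.
  by rewrite grand_term_le// e0/=; lra.
have eE : (eps `^ (theta / r) = eps `^ (theta * D) * eps `^ (theta / s))%R.
  rewrite -powRD ?(gt_eqF e0) ?implybT//; congr (_ `^ _)%R.
  by rewrite /D; ring.
(* [eps] may lie on either side of 1, whereas [p1] dominates both *)
have eD : (eps `^ (theta * D) <= p1 `^ theta)%R.
  apply: (@le_trans _ _ (p1 `^ (theta * D))%R).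
    by rewrite ge0_ler_powR ?mulr_ge0 ?nnegrE//; lra.
  by apply: ler_powR; [lra|rewrite ler_piMr].
have MD : (M `^ D <= M)%R by rewrite ler1_powR.
apply: (@le_trans _ _
    ((eps `^ (theta / r))%:E * ((M `^ D)%:E * 'N[mu]_(s%:E)[f]))).
  rewrite lee_wpmul2l ?lee_fin ?powR_ge0//.
  by apply: Lnorm_le_Lnorm => //; lra.
rewrite /grand_term -/s !muleA -!EFinM eE lee_wpmul2r ?Lnorm_ge0// lee_fin.
rewrite [leLHS](_ : _ =
  (M `^ D * eps `^ (theta * D)) * eps `^ (theta / s))%R; last by ring.
rewrite ler_wpM2r ?powR_ge0//.
by rewrite ler_pM ?powR_ge0.
Qed.

(** An enumeration of the rational points of [ ]0, p - 1] ]; every other code is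
    sent to the endpoint, so that no term of the sequence is out of range. *)
Definition rat_step p (n : nat) : R :=
  let e := ratr (odflt 0%R (unpickle n : option rat)) : R in
  if (0 < e <= p - 1)%R then e else (p - 1)%R.

Lemma rat_stepP p n : (1 < p)%R -> (0 < rat_step p n <= p - 1)%R.
Proof. by move=> p1; rewrite /rat_step; case: ifPn => // _; lra. Qed.

(** For [t < eps] the exponent [p - t] exceeds [p - eps], so the Hoelder
    comparison bounds the term at [t] from below by [h t * |f|_(p - eps)] with
    [h] continuous and [h eps] equal to the weight at [eps].  Letting rational
    [t] increase to [eps] recovers the term at [eps]. *)
Lemma grand_term_le_rat p theta M f eps (S : \bar R) :
    (0 < M)%R -> mu [set: T] <= M%:E -> measurable_fun [set: T] f ->
    (0 < eps <= p - 1)%R ->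
    (forall n, grand_term p theta f (rat_step p n) <= S) ->
  grand_term p theta f eps <= S.
Proof.
move=> M0 muM mf /andP[e0 ep] supS.
(* exponentials make continuity in both the base and the exponent visible *)
pose h (t : R) := expR (theta / (p - t) * ln t
  + ((p - t)^-1 - (p - eps)^-1) * ln M).
have hE t : (0 < t)%R ->
    h t = (t `^ (theta / (p - t)) * M `^ ((p - t)^-1 - (p - eps)^-1))%R.
  by move=> t0; rewrite /h expRD /powR !gt_eqF.
have hS (q : rat) (t : R) : t = ratr q -> (0 < t)%R -> (t < eps)%R ->
    (h t)%:E * 'N[mu]_((p - eps)%:E)[f] <= S.
  move=> tq t0 te.
  have tS : grand_term p theta f t <= S.
    have := supS (pickle q); rewrite /rat_step pickleK [odflt _ _]/= -tq.
    by rewrite ifT// t0/=; lra.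
  apply: le_trans tS.
  rewrite hE// EFinM -muleA lee_wpmul2l ?lee_fin ?powR_ge0//.
  have [a b] : (0 < p - eps)%R /\ (p - eps <= p - t)%R by split; lra.
  have := Lnorm_le_Lnorm a b M0 muM mf.
  rewrite -[((p - eps)^-1 - _)%R]opprB powRN => H.
  apply: (le_trans (lee_wpmul2l _ H)); first by rewrite lee_fin powR_ge0.
  by rewrite muleA -EFinM mulfV ?mul1e// gt_eqF// powR_gt0.
have hc : {for eps, continuous h}.
  have ptc : {for eps, continuous (fun t : R => (p - t)^-1%R)}.
    apply: cvgV; first by rewrite gt_eqF//; lra.
    by apply: cvgB; [exact: cvg_cst|exact: cvg_id].
  apply: continuous_comp; last exact: continuous_expR.
  apply: cvgD; apply: cvgM.
  - by apply: cvgM => //; exact: cvg_cst.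
  - exact: continuous_ln.
  - by apply: cvgB => //; exact: cvg_cst.
  - exact: cvg_cst.
have S0 : 0 <= S.
  apply: le_trans (supS 0%N); rewrite /grand_term.
  by rewrite mule_ge0 ?Lnorm_ge0// lee_fin powR_ge0.
have heps : h eps = (eps `^ (theta / (p - eps)))%R.
  by rewrite hE// subrr powRr0 mulr1.
rewrite leNgt /grand_term -heps; apply/negP => Slt.
(* if the norm is infinite, the term is infinite for every positive weight;
   otherwise the strict inequality persists near [eps] by continuity *)
have [e [e0' hSe]] : exists e, (0 < e)%R /\ forall t, (eps - e < t < eps)%R ->
    S < (h t)%:E * 'N[mu]_((p - eps)%:E)[f].
  have hgt0 t : (0 < h t)%R by exact: expR_gt0.
  move: (Lnorm_ge0 mu (p - eps)%:E f) Slt; case: ('N[mu]_(_)[f]) => [n| |//].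
    rewrite lee_fin => n0; move: S0; case: (S) => [s| |//] s0; last first.
      by rewrite ltNge leey.
    rewrite -EFinM lte_fin => sn.
    have /cvgr_gt/(_ _ sn)[e /= egt0 he] :
        (h t * n)%R @[t --> eps] --> (h eps * n)%R.
      by apply: cvgM => //; exact: cvg_cst.
    exists e; split => // t /andP[te1 te2]; rewrite -EFinM lte_fin.
    by apply: he => /=; rewrite ger0_norm; lra.
  move=> _ Slt; exists eps; split => // t _.
  by rewrite gt0_muley ?lte_fin//; exact: lt_le_trans Slt (leey _).
have /rat_in_itvoo[q] : (Num.max 0 (eps - e) < eps)%R.
  by rewrite gt_max e0 gtrBl.
rewrite in_itv/= gt_max => /andP[/andP[q0 qe] qeps].
have := hS q _ erefl q0 qeps; rewrite leNgt hSe//.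
by rewrite qe.
Qed.

Lemma grand_norm_esups p theta M f : (1 < p)%R -> (0 < M)%R ->
    mu [set: T] <= M%:E -> measurable_fun [set: T] f ->
  grand_norm mu p theta f =
    esups (fun n => grand_term p theta f (rat_step p n)) 0%N.
Proof.
move=> p1 M0 muM mf; apply/eqP; rewrite eq_le; apply/andP; split.
  apply: ge_ereal_sup => _ [eps /= + <-]; rewrite in_itv/= => epsp.
  apply: (grand_term_le_rat M0 muM mf epsp) => n.
  by apply: ereal_sup_ubound; exists n.
apply: ge_ereal_sup => _ [n /= _ <-].
by apply: grand_term_le; exact: rat_stepP.
Qed.

End grand_norm_facts.

(** * Integrals over a moving set *)

Section integral_restriction.
Context d (T : measurableType d) (R : realType).
Variable mu : {measure set T -> \bar R}.
Local Open Scope ereal_scope.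

Lemma ge0_integral_mrestr (D : set T) (mD : measurable D) (k : T -> \bar R) :
    (forall x, 0 <= k x) -> measurable_fun [set: T] k ->
  \int[mrestr mu mD]_x k x = \int[mu]_(x in D) k x.
Proof.
move=> k0 mk.
rewrite -(setUv D) ge0_integral_setU//; last 3 first.
- exact: measurableC.
- by rewrite setUv.
- exact/disj_set2P/setICr.
rewrite [X in _ + X](_ : _ = 0) ?adde0; last first.
  apply: null_set_integral; [exact: measurableC|exact: measurable_funTS|].
  by rewrite /= /mrestr setICl measure0.
apply: eq_measure_integral => A mA AD.
by rewrite /= /mrestr setIidl.
Qed.

(** The measures [mu] restricted to [S x] form a kernel by assumption, and the
    integral of a fixed nonnegative function against a kernel is measurable. *)
Lemma measurable_integral_section d' (X : measurableType d')
    (S : X -> set T) (mS : forall x, measurable (S x)) (k : T -> \bar R) :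
    (forall B, measurable B ->
      measurable_fun [set: X] (fun x => mu (B `&` S x))) ->
    (forall y, 0 <= k y) -> measurable_fun [set: T] k ->
  measurable_fun [set: X] (fun x => \int[mu]_(y in S x) k y).
Proof.
move=> muS k0 mk.
under eq_fun do rewrite -(ge0_integral_mrestr (mS _) k0 mk).
by apply: (@measurable_fun_integral_kernel _ _ X T R
  (fun x => mrestr mu (mS x) : {measure set T -> \bar R})).
Qed.

End integral_restriction.

Lemma measureT_le_fineD1 d (T : measurableType d) (R : realType)
    (mu : {finite_measure set T -> \bar R}) :
  (mu [set: T] <= (fine (mu [set: T]) + 1)%:E)%E.
Proof. by rewrite -[leLHS]fineK ?fin_num_measure// lee_fin lerDl. Qed.

(** * Translates of a compact set and measurability of the control function *)

Lemma embedding_continuous (X Y : topologicalType) (i : X -> Y) :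
  topological_embedding i -> continuous i.
Proof. by move=> [_ iE]; apply/continuousP => V oV; apply/iE; exists V. Qed.

Section translates.
Context (R : realType) (Omega : ptopologicalType) (G : topologicalZmodType).
Variables (iota : Omega -> G) (Q : set Omega).
Hypotheses (G_hausdorff : hausdorff_space G)
  (iota_cont : continuous iota) (Q_compact : compact Q).

Let compact_iota (K : set Omega) : compact K -> compact (iota @` K).
Proof.
by move=> cK; apply: continuous_compact => //; exact: continuous_subspaceT.
Qed.

(** The translate at [x] meets [K] exactly when [iota x] lies in the compact set
    [iota K - iota Q], which is closed as [G] is Hausdorff. *)
Lemma open_avoid_translate (K : set Omega) : compact K ->
  open [set x | K `<=` ~` translate iota Q x].
Proof.
move=> cK.
pose D := (fun z : G * G => z.1 - z.2) @` ((iota @` K) `*` (iota @` Q)).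
have cD : closed D.
  apply: compact_closed => //; apply: continuous_compact.
    by apply: continuous_subspaceT; exact: sub_continuous.
  by apply: compact_setX; exact: compact_iota.
rewrite [X in open X](_ : _ = ~` (iota @^-1` D)); last first.
  apply/seteqP; split => x /=.
    move=> KT [[a b] /= [[s Ks <-] [t Qt <-]]] stx.
    by apply: (KT _ Ks); exists t => //; rewrite -stx subrKC.
  move=> nD s Ks [t Qt st]; apply: nD; exists (iota s, iota t) => /=.
    by split; [exists s|exists t].
  by rewrite st addrAC subrr add0r.
by apply: closed_openC; move/continuous_closedP : iota_cont; apply.
Qed.

Lemma closed_translate x : closed (translate iota Q x).
Proof.
rewrite (_ : translate _ _ _ =
    iota @^-1` ((fun g => g + iota x) @` (iota @` Q))); last first.
  apply/seteqP; split => s /=.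
    by move=> [t Qt st]; exists (iota t) => //; exists t.
  by move=> [_ [t Qt <-] st]; exists t.
move/continuous_closedP : iota_cont; apply; apply: compact_closed => //.
apply: continuous_compact; last exact: compact_iota.
apply: continuous_subspaceT => g.
apply: (@continuous_comp _ _ _ (fun g => (g, iota x))
  (fun z : G * G => z.1 + z.2)).
  by apply: cvg_pair => /=; [exact: cvg_id|exact: cvg_cst].
exact: add_continuous.
Qed.

Lemma borel_closed (A : set Omega) :
  closed A -> measurable (A : set (borel Omega)).
Proof.
move=> cA; rewrite -[A]setCK.
apply: (@measurableC _ (borel Omega)); apply: sub_sigma_algebra.
exact: closed_openC.
Qed.

Variable mu : {finite_measure set (borel Omega) -> \bar R}.
Hypotheses (Omega_hausdorff : hausdorff_space Omega)
  (mu_reg : regular_measure mu).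
Local Open Scope ereal_scope.

(** Upper semicontinuity: a compact [K] off the translate at [x0] and carrying
    the mass of its complement up to [e] is still avoided by the translates at
    nearby [x], whose mass within [B] thus exceeds that at [x0] by less than
    [e]. *)
Lemma open_measure_translate_lt (B : set (borel Omega)) (a : R) :
  measurable B -> open [set x | mu (B `&` translate iota Q x) < a%:E].
Proof.
move=> mB.
(* [open] also occurs in the type of [mu]: [openE] is used for an abstract [U] *)
have opE (U : set Omega) : U `<=` U^° -> open U by rewrite openE.
apply: opE => x0 /= lta.
have mT x : measurable (translate iota Q x : set (borel Omega)).
  by apply: borel_closed; exact: closed_translate.
set A := ~` translate iota Q x0.
have mA : measurable (A : set (borel Omega)) by exact: measurableC.
have finmu (C : set (borel Omega)) : measurable C -> mu C \is a fin_num.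
  by move=> mC; exact: fin_num_measure.
have mBT : measurable (B `&` translate iota Q x0 : set (borel Omega)).
  exact: measurableI.
pose e := (a - fine (mu (B `&` translate iota Q x0)))%R.
have e0 : (0 < e)%R by rewrite subr_gt0 -lte_fin fineK// finmu.
have := finmu _ mA; rewrite (mu_reg mA) => /(ub_ereal_sup_adherent e0).
move=> [_ [K [cK KA] <-]]; rewrite -(mu_reg mA) => Ke.
have mK : measurable (K : set (borel Omega)).
  by apply: borel_closed; exact: compact_closed.
have : \forall x \near x0, K `<=` ~` translate iota Q x.
  by apply: open_nbhs_nbhs; split; [exact: open_avoid_translate|exact: KA].
apply: filterS => x KT.
apply: (@le_lt_trans _ _ (mu (B `&` translate iota Q x0) + mu (A `\` K))).
  apply: le_trans (measureU2 _ _ _); [|exact: mBT|exact: measurableD].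
  apply: le_measure; rewrite ?inE; [exact: measurableI| |].
    by apply: measurableU => //; exact: measurableD.
  move=> s [Bs Ts]; have [Tx0s|nTx0s] := pselect (translate iota Q x0 s).
    by left.
  by right; split => // Ks; exact: KT Ts.
have -> : mu (A `\` K) = mu A - mu K.
  by rewrite measureD ?(setIidr KA)// ltey_eq finmu.
have := finmu _ mK; have := finmu _ mA; have := finmu _ mBT.
move: Ke; rewrite /e.
case: (mu A) => [u| |]//; case: (mu K) => [v| |]//.
case: (mu (B `&` _)) => [w| |]//=.
by rewrite -!EFinD !lte_fin => uvw _ _ _; lra.
Qed.

Lemma measurable_measure_translate (B : set (borel Omega)) : measurable B ->
  measurable_fun [set: borel Omega] (fun x => mu (B `&` translate iota Q x)).
Proof.
move=> mB _; apply: (measurability _ (ErealGenInftyO.measurableE R)) => //.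
move=> _ [_ [a ->] <-]; rewrite setTI; apply: sub_sigma_algebra.
rewrite (_ : _ @^-1` _ = [set x | mu (B `&` translate iota Q x) < a%:E]).
  exact: open_measure_translate_lt.
by apply/seteqP; split => x /=; rewrite in_itv.
Qed.

Lemma measurable_control (p theta : R) (f : Omega -> \bar R) : (1 < p)%R ->
    measurable_fun [set: borel Omega] f ->
  measurable_fun [set: borel Omega] (control iota mu Q p theta f).
Proof.
move=> p1 mf.
have mT x : measurable (translate iota Q x : set (borel Omega)).
  by apply: borel_closed; exact: closed_translate.
have mfT x : measurable_fun [set: borel Omega] (f \_ (translate iota Q x)).
  by apply/(measurable_restrictT _ (mT x)); exact: measurable_funTS.
pose M := (fine (mu [set: borel Omega]) + 1)%R.
have M0 : (0 < M)%R by rewrite ltr_wpDl// fine_ge0.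
have muM : mu [set: borel Omega] <= M%:E by exact: measureT_le_fineD1.
rewrite (_ : control _ _ _ _ _ _ = fun x =>
    esups (fun n => grand_term mu p theta (f \_ (translate iota Q x))
                      (rat_step p n)) 0%N); last first.
  by apply/funext => x; exact: (grand_norm_esups theta p1 M0 muM (mfT x)).
apply: (@measurable_fun_esups _ (borel Omega) R setT (fun n x =>
  grand_term mu p theta (f \_ (translate iota Q x)) (rat_step p n))) => n.
apply: measurable_funeM.
have /andP[_ ep] := rat_stepP n p1.
have r0 : (p - rat_step p n != 0)%R by rewrite gt_eqF//; lra.
under eq_fun do rewrite Lnorm_patch//.
apply: (measurableT_comp (measurable_poweR _)).
apply: (@measurable_integral_section _ (borel Omega) R mu _ (borel Omega)
  (translate iota Q) mT (fun y => `|f y| `^ (p - rat_step p n))).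
- exact: measurable_measure_translate.
- by move=> y; exact: poweR_ge0.
- exact: measurable_abse_poweR.
Qed.

End translates.

(** * The inclusion *)

Section inclusion.
Context (R : realType) (Omega : ptopologicalType) (G : topologicalZmodType).
Variables (iota : Omega -> G) (Q : set Omega).
Variable mu : {finite_measure set (borel Omega) -> \bar R}.
Hypotheses (G_hausdorff : hausdorff_space G)
  (Omega_hausdorff : hausdorff_space Omega) (iota_cont : continuous iota)
  (Q_compact : compact Q).
Local Open Scope ereal_scope.

(** Only the measurability of the smaller control function needs more than the
    norm comparison, so it is kept as a hypothesis: the theorem gets it either
    from regularity or by assumption. *)
Lemma grand_amalgam_sub (p1 p2 q theta : R) (f : Omega -> \bar R) :
    (0 <= theta)%R -> (1 < p2)%R -> (p2 <= p1)%R ->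
    measurable_fun [set: borel Omega] (control iota mu Q p2 theta f) ->
  grand_amalgam iota mu Q p1 q theta f -> grand_amalgam iota mu Q p2 q theta f.
Proof.
move=> th0 p21 p21' mc2 [[mf floc] [mc1 c1fin]].
pose M := (fine (mu [set: borel Omega]) + 1)%R.
have M1 : (1 <= M)%R by rewrite lerDr fine_ge0.
have muM : mu [set: borel Omega] <= M%:E by exact: measureT_le_fineD1.
pose C := (M * p1 `^ theta)%R.
have C0 : (0 <= C)%R by rewrite mulr_ge0 ?powR_ge0//; lra.
have le_exp g : measurable_fun [set: borel Omega] g ->
    grand_norm mu p2 theta g <= C%:E * grand_norm mu p1 theta g.
  by move=> mg; exact: grand_norm_le_exponent.
have mpatch x : measurable_fun [set: borel Omega] (f \_ (translate iota Q x)).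
  have /borel_closed mT : closed (translate iota Q x).
    exact: closed_translate.
  exact/(measurable_restrictT _ mT)/measurable_funTS.
split; split => //.
- move=> K cK; have [mfK fKfin] := floc K cK.
  split => //; apply: (le_lt_trans (le_exp _ mfK)).
  by rewrite lte_mul_pinfty ?lee_fin.
- apply: (@le_lt_trans _ _
      (C%:E * grand_norm mu q theta (control iota mu Q p1 theta f))).
    apply: grand_norm_le_scale => // x.
    have := le_exp _ (mpatch x).
    by rewrite !gee0_abs ?grand_norm_ge0//; lra.
  by rewrite lte_mul_pinfty ?lee_fin.
Qed.

End inclusion.

Theorem proposition2 (R : realType)
    (G : topologicalZmodType)
    (G_hausdorff : hausdorff_space G)
    (G_lc : locally_compact [set: G])
    (Omega : ptopologicalType)
    (Omega_hausdorff : hausdorff_space Omega)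
    (Omega_lc : locally_compact [set: Omega])
    (iota : Omega -> G)
    (iota_emb : topological_embedding iota)
    (iota_borel : <<s @open G >> (range iota))
    (mu : {finite_measure set (borel Omega) -> \bar R})
    (Q : set Omega) (Q_compact : compact Q) (Q_int : interior Q !=set0)
    (theta p1 p2 q : R)
    (theta_ge0 : 0 <= theta)
    (p2_gt1 : 1 < p2) (p2_le_p1 : p2 <= p1) (q_gt1 : 1 < q) :
  (regular_measure mu ->
     grand_amalgam iota mu Q p1 q theta `<=` grand_amalgam iota mu Q p2 q theta)
  /\
  grand_amalgam iota mu Q p1 q theta
    `&` [set f | measurable_fun [set: borel Omega]
                   (control iota mu Q p2 theta f)]
    `<=` grand_amalgam iota mu Q p2 q theta.
Proof.
have iota_cont := embedding_continuous iota_emb.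
split=> [mu_reg f fW|f [fW mc]]; last exact: grand_amalgam_sub fW.
have [[mf _] _] := fW; apply: grand_amalgam_sub (fW) => //.
exact: measurable_control.
Qed.
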